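(* Let $\alpha<\beta$ be real numbers and let $R_{\alpha,\beta}=M(\{\alpha\},\{\beta\},[\alpha,\beta])$ be the Minkowski ring generated by the closed interval $[\alpha,\beta]\subseteq\mathbb{R}$ and its endpoints. Then, as $\mathbb{C}$-algebras: (1) If $0=\alpha<\beta$ or $\alpha<\beta=0$, then $R_{\alpha,\beta}\cong \mathbb{C}[x,y]/((y-1)(y-x))$. (2) If $0\notin\{\alpha,\beta\}$ and $\alpha/\beta\notin\mathbb{Q}$, then $R_{\alpha,\beta}\cong \mathbb{C}[x,y,z]/((z-x)(z-y))$. (3) If $\alpha/\beta=m/n\in\mathbb{Q}$ where $m$ and $n$ are relatively prime natural numbers, then $R_{\alpha,\beta}\cong \mathbb{C}[x,y,z]/((z-x)(z-y),\,y^m-x^n)$. (4) If $\alpha/\beta=-m/n\in\mathbb{Q}$ where $m$ and $n$ are relatively prime natural numbers, then $R_{\alpha,\beta}\cong \mathbb{C}[x,y,z]/((z-x)(z-y),\,x^ny^m-1)$.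
   Context: Natural numbers are positive integers. For $S\subseteq W=\mathbb{R}^d$ (here $d=1$), $\mathbf{1}_S=[S]:W\to\mathbb{C}$ denotes its indicator function. Let $M(\mathcal{P}(W))$ be the complex vector space of functions on $W$ spanned by the indicator functions of closed convex polyhedra; it is a commutative $\mathbb{C}$-algebra with the well-defined bilinear product determined by $[A]\cdot[B]=[A+B]$ (Minkowski sum) for nonempty closed convex polyhedra $A,B$, with unit $[\{0\}]$. For polytopes $P_1,\dots,P_n$ in $W$, the Minkowski ring $M(P_1,\dots,P_n)$ is the unital $\mathbb{C}$-subalgebra of $M(\mathcal{P}(W))$ generated by $[P_1],\dots,[P_n]$. *)

(* Defs.v *)
From HB Require Import structures.
From mathcomp Require Import all_boot all_order all_algebra.
From mathcomp Require Import lra complex mpoly.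
From mathcomp Require Import boolp classical_sets functions set_interval.
From mathcomp Require Import reals numfun.

Set Implicit Arguments.
Unset Strict Implicit.
Unset Printing Implicit Defensive.

Import Order.TTheory GRing.Theory Num.Theory.

Local Open Scope classical_set_scope.
Local Open Scope ring_scope.

Section GeneratedSubalgebra.
Variables (K : comNzRingType) (A : comAlgType K).

Definition gen_subalg (s : seq A) : {pred A} := fun a =>
  `[< forall B : {pred A}, GRing.subalg_closed B -> {subset s <= B} ->
        a \in B >].

Lemma gen_subalgP s a :
  reflect (forall B : {pred A}, GRing.subalg_closed B -> {subset s <= B} ->
             a \in B)
          (a \in gen_subalg s).
Proof. exact: asboolP. Qed.

Lemma mem_gen_subalg s : {subset s <= gen_subalg s}.
Proof. by move=> a sa; apply/gen_subalgP => B _; apply. Qed.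

Lemma gen_subalg_closed s : GRing.subsemialg_closed (gen_subalg s).
Proof.
apply: GRing.subalg_closed_semi; split.
- by apply/gen_subalgP => B [].
- move=> k u v /gen_subalgP hu /gen_subalgP hv; apply/gen_subalgP => B cB sB.
  by have [_ BL _] := cB; apply: BL; [apply: hu | apply: hv].
- move=> u v /gen_subalgP hu /gen_subalgP hv; apply/gen_subalgP => B cB sB.
  by have [_ _ BM] := cB; apply: BM; [apply: hu | apply: hv].
Qed.

HB.instance Definition _ s :=
  GRing.isSubalgClosed.Build K A (gen_subalg s) (gen_subalg_closed s).

Record subalg_of (s : seq A) :=
  Subalg { subalg_val : A; _ : subalg_val \in gen_subalg s }.

HB.instance Definition _ s := [isSub for @subalg_val s].
HB.instance Definition _ s := [Choice of subalg_of s by <:].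
HB.instance Definition _ s := [SubChoice_isSubAlgebra of subalg_of s by <:].
HB.instance Definition _ s := [SubNzRing_isSubComNzRing of subalg_of s by <:].

End GeneratedSubalgebra.

Section QuotientAlgebra.
Variables (K : comNzRingType) (A : comAlgType K).

Section ScaleQuotient.
Variable I : idealr A.
Local Notation Q := {ideal_quot I}.
Local Open Scope quotient_scope.

Definition quot_scale (k : K) (q : Q) : Q := \pi_Q (k *: repr q).

Lemma pi_scale k (a : A) : quot_scale k (\pi_Q a) = \pi_Q (k *: a).
Proof.
apply/eqP; rewrite /quot_scale -Quotient.idealrBE -scalerBr -mulr_algl.
by apply: idealMr; rewrite Quotient.idealrBE reprK.
Qed.

Lemma quot_scaleA k l q : quot_scale k (quot_scale l q) = quot_scale (k * l) q.
Proof.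
by elim/quotW: q => a; rewrite (pi_scale l) !(pi_scale _ _) scalerA.
Qed.

Lemma quot_scale1 : left_id 1 quot_scale.
Proof. by elim/quotW=> a; rewrite pi_scale scale1r. Qed.

Lemma quot_scaleDr : right_distributive quot_scale +%R.
Proof.
move=> k; elim/quotW=> a; elim/quotW=> b.
by rewrite -raddfD !pi_scale scalerDr raddfD.
Qed.

Lemma quot_scaleDl q : {morph quot_scale^~ q : k l / k + l}.
Proof.
by elim/quotW: q => a k l; rewrite !pi_scale scalerDl raddfD.
Qed.

HB.instance Definition _ := GRing.Zmodule_isLmodule.Build K Q
  quot_scaleA quot_scale1 quot_scaleDr quot_scaleDl.

Lemma quot_scaleAl k (q r : Q) : k *: (q * r) = (k *: q) * r.
Proof.
elim/quotW: q => a; elim/quotW: r => b; rewrite -rmorphM.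
rewrite [LHS]pi_scale [X in _ = X * _]pi_scale -rmorphM.
by rewrite scalerAl.
Qed.

HB.instance Definition _ := GRing.Lmodule_isLalgebra.Build K Q quot_scaleAl.
HB.instance Definition _ := GRing.Lalgebra_isComAlgebra.Build K Q.

End ScaleQuotient.

Definition gen_ideal (s : seq A) : {pred A} := fun a =>
  `[< exists c : 'I_(size s) -> A, a = \sum_(i < size s) c i * s`_i >].

(* [idealr] only admits proper ideals, because algebras are nontrivial rings. *)
Lemma gen_ideal_closed s : 1 \notin gen_ideal s -> idealr_closed (gen_ideal s).
Proof.
move=> s1; split=> //.
  by apply/asboolP; exists (fun=> 0); rewrite big1// => i _; rewrite mul0r.
move=> a u v /asboolP[c ->] /asboolP[d ->]; apply/asboolP.
exists (fun i => a * c i + d i); rewrite mulr_sumr -big_split.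
by apply: eq_bigr => i _; rewrite mulrDl mulrA.
Qed.

Definition gen_idealr s (s1 : 1 \notin gen_ideal s) : idealr A :=
  HB.pack_for (idealr A) (gen_ideal s : A -> bool)
    (isIdealr.Build A (gen_ideal s : A -> bool) (gen_ideal_closed s1)).

Definition quotient_alg s (s1 : 1 \notin gen_ideal s) : comAlgType K :=
  {ideal_quot (gen_idealr s1)}.

End QuotientAlgebra.

Arguments quotient_alg {K A} s s1.

Definition alg_iso (K : nzRingType) (A B : algType K) : Prop :=
  exists f : {lrmorphism A -> B}, bijective f.

Section Polyhedra.
Variable R : realType.
Implicit Types (P Q : set R) (a b x y : R).

(* [h = (0, b)] gives the whole line or the empty set; the indicator of the
   latter is 0, so admitting it does not enlarge the span. *)
Definition is_polyhedron P : Prop :=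
  exists hs : seq (R * R), P = [set x | all (fun h => h.1 * x <= h.2) hs].

(* [None] stands for an infinite end. *)
Definition box (e : option R * option R) : set R :=
  [set x | (if e.1 is Some l then l <= x else true) &&
           (if e.2 is Some u then x <= u else true)].

Lemma boxI e h : exists e', box e' = box e `&` [set x | h.1 * x <= h.2].
Proof.
case: e h => l u [a b] /=.
have lo c : exists e', box e' = box (l, u) `&` [set x | c <= x].
  exists (Some (if l is Some l then Num.max l c else c), u).
  apply/seteqP; split=> x /=; rewrite /box /=.
    case: l => [l|] /andP[]; rewrite ?ge_max.
      by move=> /andP[-> ->] ->.
    by move=> -> ->.
  case: l => [l|] [] /andP[]; rewrite ?ge_max.
    by move=> -> -> ->.
  by move=> _ -> ->.
have up c : exists e', box e' = box (l, u) `&` [set x | x <= c].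
  exists (l, Some (if u is Some u then Num.min u c else c)).
  apply/seteqP; split=> x /=; rewrite /box /=.
    case: u {lo} => [u|] /andP[]; rewrite ?le_min.
      by move=> -> /andP[-> ->].
    by move=> -> ->.
  case: u {lo} => [u|] [] /andP[]; rewrite ?le_min.
    by move=> -> -> ->.
  by move=> -> _ ->.
have [a0|a0|->] := ltgtP a 0.
- have [e' e'E] := lo (b / a); exists e'; rewrite e'E.
  congr (_ `&` _); apply/seteqP; split=> x /=.
    by rewrite ler_ndivrMr// mulrC.
  by rewrite ler_ndivrMr// mulrC.
- have [e' e'E] := up (b / a); exists e'; rewrite e'E.
  congr (_ `&` _); apply/seteqP; split=> x /=.
    by rewrite ler_pdivlMr// mulrC.
  by rewrite ler_pdivlMr// mulrC.
- have [b0|b0] := leP 0 b.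
    exists (l, u); apply/seteqP; split=> x /=; rewrite mul0r b0 //.
    by case.
  exists (Some 1, Some 0); apply/seteqP; split=> x /=; rewrite /box /= ?mul0r.
    by move=> /andP[x1 x0]; have := le_trans x1 x0; rewrite ler10.
  by rewrite leNgt b0 => -[].
Qed.

Lemma is_polyhedronP P : is_polyhedron P <-> exists e, P = box e.
Proof.
split=> [[hs ->{P}]|[[l u] ->]].
  elim: hs => [|h hs [e he]].
    by exists (None, None); apply/seteqP; split.
  have [e' e'E] := boxI e h; exists e'; rewrite e'E -he.
  by apply/seteqP; split=> x /=; [move=> /andP[] | move=> [-> ->]].
exists ((if l is Some l then [:: (-1, - l)] else [::]) ++
        (if u is Some u then [:: (1, u)] else [::])).
apply/seteqP; split=> x; rewrite /box /= all_cat;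
  by case: l => [l|]; case: u => [u|] /=; rewrite ?mulN1r ?lerN2 ?mul1r ?andbT.
Qed.

Lemma is_polyhedronI P Q :
  is_polyhedron P -> is_polyhedron Q -> is_polyhedron (P `&` Q).
Proof.
move=> [hs ->] [ks ->]; exists (hs ++ ks); apply/seteqP; split=> x /=.
  by rewrite all_cat => -[-> ->].
by rewrite all_cat => /andP.
Qed.

Lemma is_polyhedron_refl z P :
  is_polyhedron P -> is_polyhedron [set x | P (z - x)].
Proof.
move=> [hs ->]; exists [seq (- h.1, h.2 - h.1 * z) | h <- hs].
apply/seteqP; split=> x /=; rewrite all_map.
  by apply: sub_all => h /=; rewrite mulrBr mulNr lerBrDr addrC.
by apply: sub_all => h /=; rewrite mulrBr mulNr lerBrDr addrC.
Qed.

Definition minkowski_sum P Q : set R := [set x + y | x in P & y in Q].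

Lemma minkowski_sumE P Q z :
  minkowski_sum P Q z <-> P `&` [set x | Q (z - x)] !=set0.
Proof.
split=> [[x Px [y Qy <-]]|[x [Px /= Qx]]].
  by exists x; split=> //=; rewrite addrAC subrr add0r.
by exists x => //; exists (z - x) => //; rewrite addrCA subrr addr0.
Qed.

Lemma is_polyhedron_sum P Q :
  is_polyhedron P -> is_polyhedron Q -> is_polyhedron (minkowski_sum P Q).
Proof.
move=> pP pQ.
have p0 : is_polyhedron set0.
  by exists [:: (0, -1)]; apply/seteqP; split=> x //=; rewrite mul0r andbT ler0N1.
have [->|/set0P[p Pp]] := eqVneq P set0.
  suff -> : minkowski_sum set0 Q = set0 by [].
  by apply/seteqP; split=> x // [].
have [->|/set0P[q Qq]] := eqVneq Q set0.
  suff -> : minkowski_sum P set0 = set0 by [].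
  by apply/seteqP; split=> x // [? _ []].
move/is_polyhedronP: pP Pp => [[l u] ->] Pp.
move/is_polyhedronP: pQ Qq => [[l' u'] ->] Qq.
apply/is_polyhedronP.
exists (if (l, l') is (Some l, Some l') then Some (l + l') else None,
        if (u, u') is (Some u, Some u') then Some (u + u') else None).
apply/seteqP; split=> z.
  move=> [x + [y + <-]]; rewrite /box /=.
  move=> /andP[lx xu] /andP[ly yu]; apply/andP; split.
    by case: l l' lx ly {Pp Qq} => [l|] [l'|] // lx ly; apply: lerD.
  by case: u u' xu yu {Pp Qq} => [u|] [u'|] // xu yu; apply: lerD.
move=> zb; apply/minkowski_sumE.
exists (match l, u' with
  | Some l, Some u' => Num.max l (z - u')
  | Some l, None => l | None, Some u' => z - u'
  | None, None => match u, l' with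
    | Some u, Some l' => Num.min u (z - l')
    | Some u, None => u | None, Some l' => z - l'
    | None, None => 0 end end).
move: Pp Qq zb; rewrite /setI /box /Num.max /Num.min /=.
case: l l' u u' => [l|] [l'|] [u|] [u'|] /=; rewrite ?andbT; try (case: ifPn; rewrite -?leNgt => ?);
 move=> Pp Qq zb; repeat match goal with H : is_true (_ && _) |- _ => case/andP: H => ? ? end;
 split; try (apply/andP; split); first [by [] | lra].
Qed.

Record polyhedron :=
  Polyhedron { poly_set :> set R; polyhedronP : is_polyhedron poly_set }.

HB.instance Definition _ := gen_eqMixin polyhedron.

Definition mink_add (A B : polyhedron) : polyhedron :=
  Polyhedron (is_polyhedron_sum (polyhedronP A) (polyhedronP B)).

Lemma is_polyhedron_itv a b : is_polyhedron `[a, b].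
Proof.
apply/is_polyhedronP; exists (Some a, Some b).
by apply/seteqP; split=> x; rewrite /box /= in_itv.
Qed.

Lemma is_polyhedron1 a : is_polyhedron [set a].
Proof. by rewrite -set_itv1; exact: is_polyhedron_itv. Qed.

Definition poly_point a : polyhedron := Polyhedron (is_polyhedron1 a).

Definition poly_segment a b : polyhedron := Polyhedron (is_polyhedron_itv a b).

Local Notation C := R[i].

(* The Euler characteristic, computed on finitely many given intervals by
   evaluation at finitely many points. *)
Lemma euler_box (E : seq (option R * option R)) : exists w : seq (C * R),
  forall e, e \in E ->
    \sum_(v <- w) v.1 * \1_(box e) v.2 = `[< box e !=set0 >]%:R.
Proof.
pose ends := pmap id (map fst E ++ map snd E).
have gap (s : seq R) (p : R) :
    exists2 d : R, 0 < d & forall q, q \in s -> p < q -> p + d < q.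
  elim: s => [|q s [d d0 dP]]; first by exists 1.
  have [pq|qp] := ltP p q; last first.
    exists d => // q'; rewrite inE => /predU1P[->|]; last exact: dP.
    by rewrite ltNge qp.
  exists (Num.min d ((q - p) / 2)); first by rewrite lt_min d0/= divr_gt0 ?subr_gt0.
  move=> q'; rewrite inE => /predU1P[->|q's] pq'.
    apply: (@le_lt_trans _ _ (p + (q - p) / 2)); last lra.
    by rewrite lerD2l ge_min lexx orbT.
  apply: le_lt_trans (dP q' q's pq').
  by rewrite lerD2l ge_min lexx.
have [d d0 dP] : exists2 d : R, 0 < d &
    forall p q, p \in ends -> q \in ends -> p < q -> p + d < q.
  have [d d0 dP] : exists2 d : R, 0 < d &
      forall p q, p \in ends -> q \in ends -> p < q -> p + d < q.
    elim: {1}ends => [|p s [d d0 dP]]; first by exists 1.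
    have [d' d'0 d'P] := gap ends p.
    exists (Num.min d d'); first by rewrite lt_min d0.
    move=> p' q; rewrite inE => /predU1P[->|p's] qe pq.
      apply: le_lt_trans (d'P q qe pq).
      by rewrite lerD2l ge_min lexx orbT.
    apply: le_lt_trans (dP p' q p's qe pq).
    by rewrite lerD2l ge_min lexx.
  by exists d.
have [N NP] : exists N, forall q, q \in ends -> q < N.
  elim: {gap dP}ends => [|q s [N NP]]; first by exists 0.
  exists (Num.max N (q + 1)) => q'; rewrite inE => /predU1P[->|/NP qN].
    by rewrite lt_max ltrDl ltr01 orbT.
  by rewrite lt_max qN.
pose us := undup (pmap id (map snd E)).
exists ((1, N) :: [seq (1, p) | p <- us] ++ [seq (-1, p + d) | p <- us]).
move=> [l u] eE.
have lends l0 : l = Some l0 -> l0 \in ends.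
  move=> ll0; rewrite mem_pmap map_id mem_cat; apply/orP; left.
  by apply/mapP; exists (l, u).
have uends p : p \in us -> p \in ends.
  by rewrite mem_undup !mem_pmap !map_id mem_cat => ->; rewrite orbT.
have uus u0 : u = Some u0 -> u0 \in us.
  move=> uu0; rewrite mem_undup mem_pmap map_id.
  by apply/mapP; exists (l, u).
have boxE x : \1_(box (l, u)) x =
   ((if l is Some l then l <= x else true) &&
    (if u is Some u then x <= u else true))%:R :> C.
  rewrite indicE; congr ((_ : bool)%:R).
  by apply/idP/idP; rewrite inE.
rewrite big_cons big_cat /= !big_map -big_split /= mul1r.
have term p : p \in us ->
    1 * \1_(box (l, u)) p + -1 * \1_(box (l, u)) (p + d) =
    (if u is Some u then (p == u) && (if l is Some l then l <= u else true)
     else false)%:R :> C.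
  move=> pus; rewrite !boxE mul1r mulN1r.
  have -> : (if l is Some l then l <= p + d else true) =
            (if l is Some l then l <= p else true).
    case: l lends {eE boxE} => [l0|]// /(_ _ erefl) l0e.
    have [lp|pl] := leP l0 p; first by apply: le_trans lp _; rewrite lerDl ltW.
    by apply/negbTE; rewrite -ltNge dP// uends.
  case: u uus {eE boxE} => [u0|_]; last by rewrite subrr.
  move=> /(_ _ erefl) /uends u0e.
  have -> : (p + d <= u0) = (p < u0).
    have [pu|up] := ltP p u0; first by rewrite ltW// dP// uends.
    by apply/negbTE; rewrite -ltNge (le_lt_trans up)// ltrDl.
  have [->|pu0] := eqVneq p u0; first by rewrite ltxx lexx andbT andbF subr0.
  by rewrite lt_neqAle pu0/= subrr.
rewrite big_seq (eq_bigr _ term) -big_seq {term}.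
have Nl : (if l is Some l then l <= N else true) = true.
  by case: l lends {eE boxE} => [l0|]// /(_ _ erefl) /NP /ltW.
rewrite boxE Nl /=.
case: u uus {eE boxE uends} => [u0|_].
  move=> /(_ _ erefl) u0us.
  have -> : (N <= u0) = false.
    apply/negbTE; rewrite -ltNge NP//.
    by move: u0us; rewrite mem_undup !mem_pmap !map_id mem_cat => ->; rewrite orbT.
  rewrite add0r (bigD1_seq u0) ?undup_uniq//= eqxx/= big1 ?addr0; last first.
    by move=> p /negbTE ->.
  congr ((_ : bool)%:R); apply/idP/asboolP.
    by move=> lu; exists u0; rewrite /box /= lexx andbT.
  case=> x; rewrite /box /= => /andP[lx xu].
  by case: l lx {lends Nl} => // l0 lx; apply: le_trans lx xu.
rewrite big1// addr0; congr ((_ : bool)%:R); apply/esym/asboolP.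
by exists N; rewrite /box /= Nl.
Qed.

Lemma euler_sum (s : seq (C * polyhedron)) :
  \sum_(t <- s) t.1 *: (\1_t.2 : R -> C) = 0 ->
  \sum_(t <- s) t.1 * `[< poly_set t.2 !=set0 >]%:R = 0.
Proof.
have ends (P : polyhedron) : {e | poly_set P = box e}.
  by apply: cid; apply/is_polyhedronP; apply: polyhedronP.
move=> s0; have [w wP] := euler_box [seq sval (ends t.2) | t <- s].
transitivity (\sum_(t <- s) \sum_(v <- w) v.1 * (t.1 *: (\1_t.2 : R -> C)) v.2).
  apply: eq_big_seq => t ts; rewrite {1}(svalP (ends t.2)) -wP; last first.
    by apply/mapP; exists t.
  rewrite mulr_sumr; apply: eq_bigr => v _.
  by rewrite -(svalP (ends t.2)) mulrCA.
rewrite exchange_big big1 // => v _; rewrite -mulr_sumr.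
have /(congr1 (@^~ v.2)) := s0; rewrite fct_sumE => ->.
by rewrite mulr0.
Qed.

Definition lincomb (s : seq (C * polyhedron)) : R -> C :=
  \sum_(t <- s) t.1 *: \1_t.2.

Definition polyhedra_span : {pred R -> C} := fun f =>
  `[< exists s : seq (C * polyhedron), f = lincomb s >].

Lemma lincomb_cat s r : lincomb (s ++ r) = lincomb s + lincomb r.
Proof. exact: big_cat. Qed.

Lemma lincombZ c s : lincomb [seq (c * t.1, t.2) | t <- s] = c *: lincomb s.
Proof.
rewrite /lincomb big_map scaler_sumr; apply: eq_bigr => t _ /=.
by rewrite scalerA.
Qed.

Lemma lincomb1 (P : polyhedron) : lincomb [:: (1, P)] = \1_P.
Proof. by rewrite /lincomb big_seq1 scale1r. Qed.

Lemma polyhedra_span_closed : GRing.subsemimod_closed polyhedra_span.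
Proof.
apply: GRing.submod_closed_semi; split.
  by apply/asboolP; exists [::]; rewrite /lincomb big_nil.
move=> c f g /asboolP[s ->] /asboolP[r ->]; apply/asboolP.
by exists ([seq (c * t.1, t.2) | t <- s] ++ r); rewrite lincomb_cat lincombZ.
Qed.

HB.instance Definition _ :=
  GRing.isSubSemiModClosed.Build C (R -> C) polyhedra_span polyhedra_span_closed.

Record polyhedra_alg := PolyhedraAlg { alg_fun :> R -> C; _ : alg_fun \in polyhedra_span }.

HB.instance Definition _ := [isSub for alg_fun].
HB.instance Definition _ := [Choice of polyhedra_alg by <:].
HB.instance Definition _ := [SubChoice_isSubLmodule of polyhedra_alg by <:].

Lemma indicator_span (P : polyhedron) : (\1_P : R -> C) \in polyhedra_span.
Proof. by apply/asboolP; exists [:: (1, P)]; rewrite lincomb1. Qed.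

Definition indicator (P : polyhedron) : polyhedra_alg := PolyhedraAlg (indicator_span P).

Lemma indicator_ext (P Q : polyhedron) :
  poly_set P = poly_set Q -> indicator P = indicator Q.
Proof. by move=> PQ; apply: val_inj; rewrite /= PQ. Qed.

Definition comb (s : seq (C * polyhedron)) : polyhedra_alg :=
  \sum_(t <- s) t.1 *: indicator t.2.

Lemma val_comb s : val (comb s) = lincomb s.
Proof.
by rewrite /comb raddf_sum /=; apply: eq_bigr => t _.
Qed.

Lemma decomposition_subproof (f : polyhedra_alg) : exists s, f = comb s.
Proof.
case: f => f fP; have /asboolP[s fs] := fP.
by exists s; apply: val_inj; rewrite val_comb.
Qed.

Definition decomposition (f : polyhedra_alg) : seq (C * polyhedron) :=
  sval (cid (decomposition_subproof f)).

Lemma decompositionK f : comb (decomposition f) = f.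
Proof. by rewrite -(svalP (cid (decomposition_subproof f))). Qed.

Definition comb_mul (s r : seq (C * polyhedron)) : polyhedra_alg :=
  \sum_(t <- s) \sum_(u <- r) (t.1 * u.1) *: indicator (mink_add t.2 u.2).

(* Computed from chosen decompositions; [mink_mul_comb] shows that the choice
   is irrelevant, and [mink_mul_indicator] that [P] * [Q] = [P + Q]. *)
Definition mink_mul (f g : polyhedra_alg) : polyhedra_alg :=
  comb_mul (decomposition f) (decomposition g).

Lemma comb_add0 s (Q : polyhedron) :
  comb s = 0 -> \sum_(t <- s) t.1 *: indicator (mink_add t.2 Q) = 0.
Proof.
move=> s0; apply: val_inj; rewrite raddf_sum; apply/funext => z.
pose sl (P : polyhedron) := Polyhedron (is_polyhedronI (polyhedronP P)
  (is_polyhedron_refl z (polyhedronP Q))).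
have := @euler_sum [seq (t.1, sl t.2) | t <- s]; rewrite !big_map /= => es.
rewrite fct_sumE -[RHS]es.
  apply: eq_bigr => t _ /=; congr (_ * _); rewrite indicE; congr ((_ : bool)%:R).
  apply/idP/asboolP; rewrite inE; first by move/minkowski_sumE.
  by move=> h; apply/minkowski_sumE.
apply/funext => x; rewrite fct_sumE.
transitivity ((\sum_(t <- s) t.1 * \1_t.2 x) * \1_[set y | poly_set Q (z - y)] x).
  rewrite mulr_suml; apply: eq_bigr => t _; rewrite -mulrA; congr (_ * _).
  by rewrite indicI.
have /(congr1 (fun f : polyhedra_alg => f x)) := s0.
rewrite val_comb /lincomb fct_sumE => ->.
by rewrite mul0r.
Qed.

Lemma comb_cat s r : comb (s ++ r) = comb s + comb r.
Proof. exact: big_cat. Qed.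

Lemma combZ c s : comb [seq (c * t.1, t.2) | t <- s] = c *: comb s.
Proof.
rewrite /comb big_map scaler_sumr; apply: eq_bigr => t _ /=.
by rewrite scalerA.
Qed.

Lemma comb_mulC s r : comb_mul s r = comb_mul r s.
Proof.
rewrite /comb_mul exchange_big; apply: eq_bigr => u _; apply: eq_bigr => t _.
rewrite mulrC; congr (_ *: _); apply: indicator_ext.
by apply/seteqP; split=> z [x ? [y ? <-]]; exists y => //; exists x; rewrite // addrC.
Qed.

Lemma comb_mul_eq s s' r : comb s = comb s' -> comb_mul s r = comb_mul s' r.
Proof.
move=> ss'; apply/eqP; rewrite -subr_eq0; apply/eqP.
transitivity (comb_mul (s ++ [seq (-1 * t.1, t.2) | t <- s']) r).
  rewrite /comb_mul big_cat /= big_map; congr (_ + _).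
  rewrite -sumrN; apply: eq_bigr => t _; rewrite -sumrN; apply: eq_bigr => u _.
  by rewrite mulN1r mulNr scaleNr.
have : comb (s ++ [seq (-1 * t.1, t.2) | t <- s']) = 0.
  by rewrite comb_cat combZ ss' scaleN1r subrr.
move: (_ ++ _) => q q0; rewrite /comb_mul exchange_big big1// => u _ /=.
transitivity (u.1 *: \sum_(t <- q) t.1 *: indicator (mink_add t.2 u.2)).
  by rewrite scaler_sumr; apply: eq_bigr => t _; rewrite scalerA mulrC.
by rewrite comb_add0// scaler0.
Qed.

Lemma mink_mul_comb s r : mink_mul (comb s) (comb r) = comb_mul s r.
Proof.
rewrite /mink_mul (@comb_mul_eq _ s) ?decompositionK// comb_mulC.
by rewrite (@comb_mul_eq _ r) ?decompositionK// comb_mulC.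
Qed.

Lemma comb1 (P : polyhedron) : comb [:: (1, P)] = indicator P.
Proof. by rewrite /comb big_seq1 scale1r. Qed.

Lemma mink_mul_indicator (P Q : polyhedron) :
  mink_mul (indicator P) (indicator Q) = indicator (mink_add P Q).
Proof.
by rewrite -!comb1 mink_mul_comb /comb_mul !big_seq1 mulr1 comb1 scale1r.
Qed.

Lemma mink_mulC : commutative mink_mul.
Proof. by move=> f g; rewrite /mink_mul comb_mulC. Qed.

Lemma mink_mulDl : left_distributive mink_mul +%R.
Proof.
move=> f g h; rewrite -(decompositionK f) -(decompositionK g) -(decompositionK h).
by rewrite -comb_cat !mink_mul_comb /comb_mul big_cat.
Qed.

Lemma mink_mulAl c f g : c *: mink_mul f g = mink_mul (c *: f) g.
Proof.
rewrite -(decompositionK f) -(decompositionK g) -combZ !mink_mul_comb /comb_mul.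
rewrite big_map scaler_sumr; apply: eq_bigr => t _; rewrite scaler_sumr.
by apply: eq_bigr => u _; rewrite scalerA mulrA.
Qed.

Lemma mink_mul0l g : mink_mul 0 g = 0.
Proof. by rewrite -[X in mink_mul X _](scale0r 0) -mink_mulAl scale0r. Qed.

Lemma polyhedra_alg_ind (X : polyhedra_alg -> Prop) :
  (forall P : polyhedron, X (indicator P)) -> (forall c f g, X f -> X g -> X (c *: f + g)) ->
  X 0 -> forall f, X f.
Proof.
move=> XI XL X0 f; rewrite -(decompositionK f); elim: (decomposition f) => [|t s IH].
  by rewrite /comb big_nil.
by rewrite /comb big_cons; apply: XL.
Qed.

Lemma mink_mulA : associative mink_mul.
Proof.
have lin c f f' g : mink_mul (c *: f + f') g = c *: mink_mul f g + mink_mul f' g.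
  by rewrite mink_mulDl mink_mulAl.
have linr c f f' g : mink_mul g (c *: f + f') = c *: mink_mul g f + mink_mul g f'.
  by rewrite -!(mink_mulC _ g).
have mul0r g : mink_mul g 0 = 0 by rewrite mink_mulC mink_mul0l.
move=> f g h; move: f.
apply: polyhedra_alg_ind => [P|c f f' Hf Hf'|]; last 2 first.
- by rewrite !lin Hf Hf'.
- by rewrite !mink_mul0l.
move: g; apply: polyhedra_alg_ind => [Q|c f f' Hf Hf'|]; last 2 first.
- by rewrite lin !linr lin Hf Hf'.
- by rewrite !(mink_mul0l, mul0r).
move: h; apply: polyhedra_alg_ind => [S|c f f' Hf Hf'|]; last 2 first.
- by rewrite !linr Hf Hf'.
- by rewrite !mul0r.
rewrite !mink_mul_indicator; apply: indicator_ext; apply/seteqP; split=> z.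
  move=> [x Px [_ [y Qy [w Sw <-]] <-]].
  by exists (x + y); [exists x => //; exists y | exists w; rewrite // addrA].
move=> [_ [x Px [y Qy <-]] [w Sw <-]].
by exists x => //; exists (y + w); [exists y => //; exists w | rewrite addrA].
Qed.

Lemma mink_mul1 : left_id (indicator (poly_point 0)) mink_mul.
Proof.
apply: polyhedra_alg_ind => [P|c f g Hf Hg|].
- rewrite mink_mul_indicator; apply: indicator_ext; apply/seteqP; split=> z /=.
    by move=> [x -> [y Py <-]]; rewrite add0r.
  by move=> Pz; exists 0 => //; exists z; rewrite ?add0r.
- by rewrite mink_mulC mink_mulDl -mink_mulAl !(mink_mulC _ (indicator _)) Hf Hg.
- by rewrite mink_mulC mink_mul0l.
Qed.

Lemma mink_one_neq0 : indicator (poly_point 0) != 0.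
Proof.
apply/eqP => /(congr1 (fun f : polyhedra_alg => f 0)) /eqP.
by rewrite /= indicE mem_set//= oner_eq0.
Qed.

HB.instance Definition _ := GRing.Zmodule_isComNzRing.Build polyhedra_alg
  mink_mulA mink_mulC mink_mul1 mink_mulDl mink_one_neq0.
HB.instance Definition _ :=
  GRing.Lmodule_isLalgebra.Build C polyhedra_alg mink_mulAl.
HB.instance Definition _ := GRing.Lalgebra_isComAlgebra.Build C polyhedra_alg.

Definition minkowski_ring (Ps : seq polyhedron) : comAlgType C :=
  subalg_of (map indicator Ps).

End Polyhedra.

Section Relations.
Variable K : fieldType.

Lemma common_root_proper n (v : 'I_n -> K) (s : seq {mpoly K[n]}) :
  (forall i : 'I_(size s), (s`_i).@[v] = 0) -> 1 \notin gen_ideal s.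
Proof.
move=> s0; apply/negP => /asboolP[c /(congr1 (meval v))].
rewrite meval1 raddf_sum /= big1 => [/eqP|i _]; first by rewrite oner_eq0.
by rewrite mevalM s0 mulr0.
Qed.

Local Notation x := ('X_0).
Local Notation y := ('X_1).
Local Notation z := ('X_2).

Lemma proper_xy :
  1 \notin gen_ideal ([:: (y - 1) * (y - x)] : seq {mpoly K[2]}).
Proof.
apply: (@common_root_proper _ (fun=> 1)) => -[[|i]//= _].
by rewrite mevalM !mevalB !mevalXU subrr mulr0.
Qed.

Lemma proper_xyz :
  1 \notin gen_ideal ([:: (z - x) * (z - y)] : seq {mpoly K[3]}).
Proof.
apply: (@common_root_proper _ (fun=> 1)) => -[[|i]//= _].
by rewrite mevalM !mevalB !mevalXU subrr mulr0.
Qed.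

Lemma proper_xyz_pos m n :
  1 \notin gen_ideal
    ([:: (z - x) * (z - y); y ^+ m - x ^+ n] : seq {mpoly K[3]}).
Proof.
apply: (@common_root_proper _ (fun=> 1)) => -[[|[|i]]//= _].
  by rewrite mevalM !mevalB !mevalXU subrr mulr0.
by rewrite mevalB !rmorphXn /= !mevalXU !expr1n subrr.
Qed.

Lemma proper_xyz_neg m n :
  1 \notin gen_ideal
    ([:: (z - x) * (z - y); x ^+ n * y ^+ m - 1] : seq {mpoly K[3]}).
Proof.
apply: (@common_root_proper _ (fun=> 1)) => -[[|[|i]]//= _].
  by rewrite mevalM !mevalB !mevalXU subrr mulr0.
by rewrite mevalB mevalM meval1 !rmorphXn /= !mevalXU !expr1n mulr1 subrr.
Qed.

End Relations.

(* Main.v *)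
(* The identity [z^2 = (x + y) z - x y] puts every element of a
   presented algebra in the form [a + b z] with [a], [b] linear combinations of
   monomials [x^i y^j].  Its image is a combination of points [{w}] and segments
   [[w + alpha, w + beta]], where [w = i alpha + j beta] is the weight of the
   monomial.  Points of distinct abscissae and translates of a segment are
   linearly independent, so in the kernel the coefficients of the monomials of
   any given weight sum to zero.  The remaining relation of each presentation
   says exactly that monomials of equal weight coincide, whence [a = b = 0]. *)
Require Import Defs.
From HB Require Import structures.
From mathcomp Require Import all_boot all_order all_algebra.
From mathcomp Require Import ring lra zify complex mpoly.
From mathcomp Require Import boolp classical_sets set_interval.
From mathcomp Require Import reals numfun.

Set Implicit Arguments.
Unset Strict Implicit.
Unset Printing Implicit Defensive.

Import Order.TTheory GRing.Theory Num.Theory.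

Local Open Scope ring_scope.

(** * Morphisms of algebras out of a quotient *)

(** The factor is [f] after a set-theoretic section [s] of [p]. Two preimages of one element differ
    by an element of the kernel of [p], which [f] kills, so the choice of section does not matter
    and [g] inherits every operation. *)
Lemma lrmorphism_factor (K : nzRingType) (A B C : algType K)
    (p : {lrmorphism A -> B}) (f : {lrmorphism A -> C}) :
  (forall b, exists a, p a = b) -> (forall a, p a = 0 -> f a = 0) ->
  exists g : {lrmorphism B -> C}, forall a, g (p a) = f a.
Proof.
move=> psurj pf; have [s sK] := choice psurj.
have fE a a' : p a = p a' -> f a = f a'.
  move=> e; apply/eqP; rewrite -subr_eq0 -linearB; apply/eqP/pf.
  by rewrite linearB /= e subrr.
pose g b := f (s b).
have gE a : g (p a) = f a by apply: fE; rewrite sK.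
have gD : zmod_morphism g.
  by move=> b c; rewrite /g -linearB; apply: fE; rewrite linearB /= !sK.
have gM : monoid_morphism g.
  split; first by rewrite -(rmorph1 p) gE rmorph1.
  by move=> b c; rewrite /g -rmorphM; apply: fE; rewrite rmorphM /= !sK.
have gZ : scalable g.
  by move=> k b; rewrite /g -linearZ; apply: fE; rewrite linearZ /= !sK.
pose m1 := GRing.isZmodMorphism.Build _ _ g gD.
pose m2 := GRing.isMonoidMorphism.Build _ _ g gM.
pose m3 := GRing.isScalable.Build _ _ _ _ g gZ.
by exists (HB.pack_for {lrmorphism B -> C} g m1 m2 m3).
Qed.

Section Projection.
Variables (K : comNzRingType) (A : comAlgType K) (s : seq A).
Variable s1 : 1 \notin gen_ideal s.
Local Open Scope quotient_scope.

(** Surjectivity and the kernel are all that is used of the quotient afterwards. *)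
Lemma quotient_alg_proj : exists p : {lrmorphism A -> quotient_alg s s1},
  (forall q, exists a, p a = q) /\ (forall a, p a = 0 <-> a \in gen_ideal s).
Proof.
pose Q : comAlgType K := {ideal_quot (gen_idealr s1)}.
pose p a : Q := \pi_({ideal_quot (gen_idealr s1)}) a.
have pD : zmod_morphism p by exact: raddfB.
have pM : monoid_morphism p by split; [exact: rmorph1 | exact: rmorphM].
have pZ : scalable p by move=> k a; rewrite /p -pi_scale.
pose m1 := GRing.isZmodMorphism.Build _ _ p pD.
pose m2 := GRing.isMonoidMorphism.Build _ _ p pM.
pose m3 := GRing.isScalable.Build _ _ _ _ p pZ.
exists (HB.pack_for {lrmorphism A -> Q} p m1 m2 m3); split.
  by move=> q; exists (repr q); rewrite /= /p reprK.
move=> a; rewrite /= /p.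
have := Quotient.idealrBE (gen_idealr s1) a 0.
rewrite subr0 => ->.
by split=> [e|/eqP]; [apply/eqP; rewrite e raddf0 | rewrite raddf0].
Qed.
End Projection.

(** * Generated subalgebras and their normal forms *)

Section Subalgebra.
Variables (K : comNzRingType) (A : comAlgType K).

(** The generated subalgebra lies in every closed predicate containing [s], and the hypotheses make
    [P] such a predicate. *)
Lemma gen_subalg_ind (s : seq A) (P : A -> Prop) :
  (forall a, a \in s -> P a) -> P 1 ->
  (forall k a b, P a -> P b -> P (k *: a + b)) ->
  (forall a b, P a -> P b -> P (a * b)) -> forall a, a \in gen_subalg s -> P a.
Proof.
move=> Ps P1 PL PM a /gen_subalgP/(_ (fun x => `[< P x >])) h.
apply/asboolP; apply: h => [|b bs]; last by apply/asboolP/Ps.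
split; first exact/asboolP.
  by move=> k u v /asboolP Pu /asboolP Pv; apply/asboolP/PL.
by move=> u v /asboolP Pu /asboolP Pv; apply/asboolP/PM.
Qed.

(** The list may repeat a monomial; terms are collected only later, and then by weight. *)
Lemma gen_subalg_monomials (X Y a : A) : a \in gen_subalg [:: X; Y] ->
  exists s : seq (K * (nat * nat)),
    a = \sum_(t <- s) t.1 *: (X ^+ t.2.1 * Y ^+ t.2.2).
Proof.
move: a; apply: gen_subalg_ind.
- move=> a; rewrite !inE => /orP[]/eqP ->.
    by exists [:: (1, (1, 0))]; rewrite big_seq1 scale1r mulr1 expr1.
  by exists [:: (1, (0, 1))]; rewrite big_seq1 scale1r mul1r expr1.
- by exists [:: (1, (0, 0))]; rewrite big_seq1 scale1r mulr1.
- move=> k _ _ [s ->] [r ->]; exists ([seq (k * t.1, t.2) | t <- s] ++ r).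
  rewrite big_cat big_map scaler_sumr; congr (_ + _).
  by apply: eq_bigr => t _; rewrite scalerA.
move=> _ _ [s ->] [r ->].
exists [seq (t.1 * u.1, (t.2.1 + u.2.1, t.2.2 + u.2.2)%N) | t <- s, u <- r].
rewrite big_allpairs_dep mulr_suml; apply: eq_bigr => t _.
rewrite mulr_sumr; apply: eq_bigr => u _ /=.
by rewrite -scalerAl -scalerAr scalerA !exprD mulrACA.
Qed.

(** The relation rewrites [Z * Z] as a polynomial of degree one in [Z], so elements of this form are
    closed under products. *)
Lemma gen_subalg_quadratic (X Y Z a : A) : (Z - X) * (Z - Y) = 0 ->
  a \in gen_subalg [:: X; Y; Z] ->
  exists b c, [/\ b \in gen_subalg [:: X; Y], c \in gen_subalg [:: X; Y] &
    a = b + c * Z].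
Proof.
move=> ZXY.
have Z2 : Z * Z = (X + Y) * Z - X * Y.
  by apply/eqP; rewrite -subr_eq0 -ZXY; apply/eqP; ring.
have XS : X \in gen_subalg [:: X; Y].
  by apply: mem_gen_subalg; rewrite !inE eqxx.
have YS : Y \in gen_subalg [:: X; Y].
  by apply: mem_gen_subalg; rewrite !inE eqxx orbT.
move: a; apply: gen_subalg_ind.
- move=> a; rewrite !inE => /or3P[]/eqP ->.
  + by exists X, 0; rewrite rpred0 mul0r addr0.
  + by exists Y, 0; rewrite rpred0 mul0r addr0.
  + by exists 0, 1; rewrite rpred0 rpred1 mul1r add0r.
- by exists 1, 0; rewrite rpred0 rpred1 mul0r addr0.
- move=> k _ _ [b [c [bS cS ->]]] [b' [c' [b'S c'S ->]]].
  exists (k *: b + b'), (k *: c + c'); rewrite !rpredD ?rpredZ//; split=> //.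
  by rewrite scalerDr mulrDl scalerAl addrACA.
move=> _ _ [b [c [bS cS ->]]] [b' [c' [b'S c'S ->]]].
exists (b * b' - c * c' * (X * Y)), (b * c' + c * b' + c * c' * (X + Y)).
split; rewrite ?(rpredB, rpredD, rpredM)//.
transitivity (b * b' + (b * c' + c * b') * Z + c * c' * (Z * Z)); first by ring.
by rewrite Z2; ring.
Qed.

End Subalgebra.

Lemma mpoly_gen_subalg (K : comNzRingType) n (s : seq {mpoly K[n]}) :
  (forall i, 'X_i \in s) -> forall p, p \in gen_subalg s.
Proof.
move=> Xs p; rewrite (mpolyE p); apply: rpred_sum => m _; apply: rpredZ.
rewrite mpolyXE_id; apply: rpred_prod => i _; apply: rpredX.
exact: mem_gen_subalg.
Qed.

Lemma mpoly_lift (K : comNzRingType) (A : comAlgType K) n (v : 'I_n -> A) :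
  exists f : {lrmorphism {mpoly K[n]} -> A}, forall i, f 'X_i = v i.
Proof.
pose f := mmap (in_alg A) v.
have fZ : scalable f by move=> k p; rewrite /f mmapZ /= mulr_algl.
pose m := GRing.isScalable.Build _ _ _ _ f fZ.
exists (HB.pack_for {lrmorphism {mpoly K[n]} -> A} f m) => i /=.
by rewrite /f mmapX mmap1U.
Qed.

Lemma gen_subalg_image (K : comNzRingType) (A B : comAlgType K)
    (f : {lrmorphism A -> B}) s a :
  a \in gen_subalg s -> f a \in gen_subalg (map f s).
Proof.
move: a; apply: gen_subalg_ind.
- by move=> a sa; apply: mem_gen_subalg; apply: map_f.
- by rewrite rmorph1 rpred1.
- by move=> k a b fa fb; rewrite linearP rpredD ?rpredZ.
- by move=> a b fa fb; rewrite rmorphM rpredM.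
Qed.

(** The image of [f] is generated by the images of the generators of [A], and [f] is injective. *)
Lemma gen_subalg_iso (K : comNzRingType) (A B : comAlgType K)
    (f : {lrmorphism A -> B}) s :
  (forall a, a \in gen_subalg s) -> (forall a, f a = 0 -> a = 0) ->
  alg_iso (subalg_of (map f s)) A.
Proof.
move=> sA f0.
pose g a : subalg_of (map f s) := Subalg (gen_subalg_image f (sA a)).
have gB : zmod_morphism g by move=> a b; apply: val_inj; rewrite /= raddfB.
have gM : monoid_morphism g.
  by split=> [|a b]; apply: val_inj; rewrite /= ?rmorph1 ?rmorphM.
have gZ : scalable g by move=> k a; apply: val_inj; rewrite /= linearZ.
pose m1 := GRing.isZmodMorphism.Build _ _ g gB.
pose m2 := GRing.isMonoidMorphism.Build _ _ g gM.
pose m3 := GRing.isScalable.Build _ _ _ _ g gZ.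
pose G := HB.pack_for {lrmorphism A -> subalg_of (map f s)} g m1 m2 m3.
have surj u : exists a, G a = u.
  case: u => b bs; suff [a ab] : exists a, f a = b.
    by exists a; apply: val_inj.
  move: b bs; apply: gen_subalg_ind.
  - by move=> _ /mapP[a _ ->]; exists a.
  - by exists 1; rewrite rmorph1.
  - by move=> k _ _ [a <-] [b <-]; exists (k *: a + b); rewrite linearP.
  - by move=> _ _ [a <-] [b <-]; exists (a * b); rewrite rmorphM.
(* The identity of [A] factors through the surjection [G], because [G] has zero kernel; the factor
   is the inverse of [G] as a morphism. *)
have [h hK] := @lrmorphism_factor K A (subalg_of (map f s)) A G idfun surj
  (fun a Ga => f0 a (congr1 val Ga)).
exists h; exists G => [u|a]; last exact: hK.
by have [a <-] := surj u; rewrite hK.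
Qed.

(** * Collecting terms and linear independence of points and segments *)

(** Adding an entry [t] to [r] changes only the coefficient at [w t], which occurs exactly once in
    [s]. *)
Lemma sum_fibers (K : pzRingType) (V : lmodType K) (T : Type) (I : eqType)
    (r : seq T) (s : seq I) (c : T -> K) (w : T -> I) (h : I -> V) :
  uniq s -> all (fun t => w t \in s) r ->
  \sum_(t <- r) c t *: h (w t) =
  \sum_(v <- s) (\sum_(t <- r | w t == v) c t) *: h v.
Proof.
move=> us; elim: r => [_|t r IH /= /andP[ts rs]].
  by rewrite big_nil big1// => v _; rewrite big_nil scale0r.
rewrite big_cons IH// (bigD1_seq (w t))//= [RHS](bigD1_seq (w t))//=.
rewrite big_cons eqxx scalerDl addrA; congr (_ + _).
by apply: eq_bigr => v; rewrite eq_sym big_cons => /negbTE ->.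
Qed.

Section Order.
Variable R : realType.

Lemma seq_min (s : seq R) v : v \in s ->
  exists2 x, x \in s & forall y, y \in s -> x <= y.
Proof.
elim: s v => // a [|b s] IH v _.
  by exists a; rewrite ?mem_head// => y; rewrite inE => /eqP ->.
have [x xs xP] := IH b (mem_head _ _).
have [ax|xa] := leP a x.
  exists a; first exact: mem_head.
  by move=> y; rewrite inE => /predU1P[->//|/xP]; apply: le_trans.
exists x; first by rewrite inE xs orbT.
by move=> y; rewrite inE => /predU1P[->|/xP//]; apply: ltW.
Qed.

(** Finitely many entries exceed [p], so a point close enough to [p] precedes them all. This yields
    the evaluation point in [segments_points_free]. *)
Lemma seq_gap (s : seq R) p q : p < q ->
  exists2 u, p < u < q & forall v, v \in s -> p < v -> u < v.
Proof.
move=> pq; elim: s => [|a s [u /andP[pu uq] us]].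
  by exists ((p + q) / 2) => //; apply/andP; split; lra.
have [pa|ap] := ltP p a; last first.
  exists u; first by rewrite pu.
  by move=> v; rewrite inE => /predU1P[->|/us//]; rewrite ltNge ap.
exists (Num.min u ((p + a) / 2)).
  by rewrite lt_min gt_min pu uq andbT; lra.
move=> v; rewrite inE => /predU1P[->|vs] pv.
  by rewrite gt_min; apply/orP; right; lra.
by rewrite gt_min us.
Qed.

Variables (C : nzRingType) (alpha beta : R).
Hypothesis ab : alpha < beta.

(* Just to the right of [w + alpha], where [w] is the least index with
   [b w != 0], the interval attached to [w] is the only contribution left. *)
Lemma segments_points_free (s r : seq R) (a b : R -> C) : uniq s -> uniq r ->
  (forall u, \sum_(v <- s) a v * (u == v)%:R +
     \sum_(v <- r) b v * ((v + alpha <= u <= v + beta)%R)%:R = 0) ->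
  (forall v, v \in s -> a v = 0) /\ (forall v, v \in r -> b v = 0).
Proof.
move=> us ur ab0.
have b0 v : v \in r -> b v = 0.
  move=> vr; apply/eqP; apply: contraT => bv.
  have [|w] := @seq_min [seq x <- r | b x != 0] v.
    by rewrite mem_filter bv.
  rewrite mem_filter => /andP[bw wr] wmin.
  have wab : w + alpha < w + beta by rewrite ltrD2l.
  have [u /andP[wu uw] uP] := seq_gap (s ++ [seq x + alpha | x <- r]) wab.
  (* No point of [s] equals [u]: it would exceed [w + alpha] and hence lie strictly beyond [u]. *)
  have := ab0 u; rewrite big1_seq ?add0r => [|x /= xs]; last first.
    have [ux|] := eqVneq u x; last by rewrite mulr0.
    have := uP x; rewrite mem_cat xs -ux wu => /(_ isT isT).
    by rewrite ltxx.
  rewrite (bigD1_seq w)//= (ltW wu) (ltW uw) mulr1 big1_seq ?addr0.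
    by move/eqP: bw.
  move=> x /andP[xw xr]; have [->|bx] := eqVneq (b x) 0; first by rewrite mul0r.
  (* By minimality of [w], any other index with nonzero coefficient is larger, so its interval
     starts beyond [u]. *)
  have wx : w < x by rewrite lt_neqAle eq_sym xw wmin// mem_filter bx.
  suff -> : (x + alpha <= u) = false by rewrite mulr0.
  apply/negbTE; rewrite -ltNge uP ?ltrD2r// mem_cat.
  by apply/orP; right; apply: map_f.
(* Once the intervals are gone, evaluation at [v] isolates [a v]. *)
split=> // v vs; have := ab0 v.
rewrite [X in _ + X]big1_seq ?addr0 => [|x /= /b0 ->]; last by rewrite mul0r.
rewrite (bigD1_seq v)//= eqxx mulr1 big1 ?addr0// => x.
by rewrite eq_sym => /negbTE ->; rewrite mulr0.
Qed.
End Order.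

(** * Minkowski products of points and segments *)

Section Indicators.
Variable R : realType.
Implicit Types a b c d u : R.

Lemma polyhedra_alg_sumE (I : Type) (r : seq I) (c : I -> R[i])
    (g : I -> polyhedra_alg R) u :
  (\sum_(v <- r) c v *: g v) u = \sum_(v <- r) c v * g v u.
Proof. by elim: r => [|v r IH]; rewrite ?big_nil ?big_cons//= -IH. Qed.

(** Treating points as degenerate segments lets one product formula serve for both. *)
Lemma indicator_point a :
  indicator (poly_point a) = indicator (poly_segment a a).
Proof. by apply: indicator_ext; rewrite /= set_itv1. Qed.

Lemma indicator_segmentE a b u :
  indicator (poly_segment a b) u = ((a <= u <= b)%R)%:R.
Proof.
rewrite /= indicE; congr ((_ : bool)%:R).
by apply/idP/idP; rewrite inE /= in_itv.
Qed.

Lemma indicator_segmentM a b c d : a <= b -> c <= d ->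
  indicator (poly_segment a b) * indicator (poly_segment c d) =
  indicator (poly_segment (a + c) (b + d)).
Proof.
move=> ab cd; rewrite [LHS]mink_mul_indicator; apply: indicator_ext.
rewrite /= !set_itvE; apply/seteqP; split=> z /=.
  by move=> [x /= xP [y /= yP <-]]; lra.
(* Up to [b + c] the second summand can stay at [c]; beyond it the first can stay at [b]. *)
move=> zP; have [zb|zb] := leP z (b + c).
  by exists (z - c) => /=; [lra | exists c => /=; [lra | rewrite subrK]].
exists b => /=; first by lra.
by exists (z - b) => /=; [lra | rewrite addrC subrK].
Qed.

Lemma indicator_pointM a b :
  indicator (poly_point a) * indicator (poly_point b) =
  indicator (poly_point (a + b)).
Proof. by rewrite !indicator_point indicator_segmentM. Qed.

Lemma indicator_pointX a n :
  indicator (poly_point a) ^+ n = indicator (poly_point (a *+ n)).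
Proof.
elim: n => [|n IH]; first by rewrite mulr0n.
by rewrite exprS IH indicator_pointM mulrS.
Qed.

(** The expanded product is inclusion-exclusion for the segment from [a + a] to [b + b] cut at
    [a + b]: the whole, minus the two halves, plus the common point. *)
Lemma indicator_segment_quadratic a b : a <= b ->
  (indicator (poly_segment a b) - indicator (poly_point a)) *
  (indicator (poly_segment a b) - indicator (poly_point b)) = 0.
Proof.
move=> ab; rewrite !indicator_point mulrBl !mulrBr !indicator_segmentM//.
apply: val_inj; apply/funext => u.
transitivity (((a + a <= u <= b + b)%R)%:R - ((a + b <= u <= b + b)%R)%:R -
  (((a + a <= u <= a + b)%R)%:R - ((a + b <= u <= a + b)%R)%:R) : R[i]).
  by rewrite -!indicator_segmentE.
have [u1|u1] := leP (a + b) u; have [u2|u2] := leP u (a + b);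
  rewrite ?andbT ?andbF/=.
- have -> : a + a <= u by lra.
  have -> : u <= b + b by lra.
  by rewrite !subrr.
- have -> : a + a <= u by lra.
  by rewrite !subrr.
- have -> : u <= b + b by lra.
  by rewrite andbT !subr0 subrr.
- by have := lt_trans u1 u2; rewrite ltxx.
Qed.

(** * A criterion for presenting the Minkowski ring *)

Section Iso.
Variables (alpha beta : R) (A : comAlgType R[i]) (X Y Z : A).
Variable f : {lrmorphism A -> polyhedra_alg R}.
Hypothesis ab : alpha < beta.
Hypothesis fX : f X = indicator (poly_point alpha).
Hypothesis fY : f Y = indicator (poly_point beta).
Hypothesis fZ : f Z = indicator (poly_segment alpha beta).
Hypothesis ZXY : (Z - X) * (Z - Y) = 0.
Hypothesis XYZ : forall q : A, q \in gen_subalg [:: X; Y; Z].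

Let w (t : R[i] * (nat * nat)) : R := alpha *+ t.2.1 + beta *+ t.2.2.
Hypothesis XY : forall i j i' j',
  alpha *+ i + beta *+ j = alpha *+ i' + beta *+ j' ->
  X ^+ i * Y ^+ j = X ^+ i' * Y ^+ j'.

Lemma minkowski_presentation_inj (q : A) : f q = 0 -> q = 0.
Proof.
have [b [c [/gen_subalg_monomials[s ->] /gen_subalg_monomials[r ->] ->]]] :=
  gen_subalg_quadratic ZXY (XYZ q).
(* [h v] is the common value of all monomials of weight [v], well defined by [XY], and 0 where [v]
   is not a weight. *)
have [h hE] : exists h : R -> A,
    forall t : R[i] * (nat * nat), X ^+ t.2.1 * Y ^+ t.2.2 = h (w t).
  have /choice[h hP] : forall v, exists z : A, forall t, w t = v ->
      X ^+ t.2.1 * Y ^+ t.2.2 = z.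
    move=> v; have [[t tv]|nt] := pselect (exists t, w t = v).
      exists (X ^+ t.2.1 * Y ^+ t.2.2) => t' t'v; apply: XY.
      by rewrite -/(w t') t'v -tv.
    by exists 0 => t tv; case: nt; exists t.
  by exists h => t; apply: hP.
have fh t : f (h (w t)) = indicator (poly_point (w t)).
  by rewrite -hE rmorphM !rmorphXn /= fX fY !indicator_pointX indicator_pointM.
have fhZ t : f (h (w t) * Z) =
    indicator (poly_segment (w t + alpha) (w t + beta)).
  rewrite rmorphM /= fh fZ indicator_point indicator_segmentM//.
  exact: ltW.
(* The total coefficient in [l] of the monomials of weight [v]. *)
pose fib (l : seq (R[i] * (nat * nat))) v := \sum_(t <- l | w t == v) t.1.
have fibE (V : lmodType R[i]) (g : R -> V) (l : seq (R[i] * (nat * nat))) :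
    \sum_(t <- l) t.1 *: g (w t) = \sum_(v <- undup (map w l)) fib l v *: g v.
  apply: sum_fibers; first exact: undup_uniq.
  by apply/allP => t tq; rewrite mem_undup map_f.
under eq_bigr => t _ do rewrite hE.
under [X in _ + X * _]eq_bigr => t _ do rewrite hE.
rewrite mulr_suml; under [X in _ + X]eq_bigr => t _ do rewrite -scalerAl.
rewrite (fibE _ h) (fibE _ (fun v => h v * Z)) => fa0.
have fa : \sum_(v <- undup (map w s)) fib s v *: indicator (poly_point v) +
    \sum_(v <- undup (map w r)) fib r v *:
      indicator (poly_segment (v + alpha) (v + beta)) = 0.
  rewrite -(fibE _ (fun v => indicator (poly_point v))).
  rewrite -(fibE _ (fun v => indicator (poly_segment (v + alpha) (v + beta)))).
  rewrite -[RHS]fa0 -(fibE _ h) -(fibE _ (fun v => h v * Z)) raddfD.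
  rewrite !raddf_sum /=.
  by congr (_ + _); apply: eq_bigr => t _; rewrite linearZ /= ?fh ?fhZ.
have [] := segments_points_free ab (undup_uniq (map w s))
  (undup_uniq (map w r)) (a := fib s) (b := fib r).
  move=> u; have /(congr1 (fun g : polyhedra_alg R => g u)) := fa.
  rewrite -[RHS]/(0 : R[i]) => fu; rewrite -[RHS]fu.
  (* Addition, unlike the product, is pointwise by conversion, so the value at [u] splits into a
     point sum and a segment sum. *)
  rewrite -[RHS]/((_ : polyhedra_alg R) u + (_ : polyhedra_alg R) u).
  rewrite !polyhedra_alg_sumE; congr (_ + _); apply: eq_bigr => v _.
    by rewrite indicator_point indicator_segmentE -eq_le eq_sym.
  by rewrite indicator_segmentE.
move=> s0 r0; rewrite !big1_seq ?addr0// => v /= vP.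
  by rewrite r0 ?scale0r.
by rewrite s0 ?scale0r.
Qed.

Lemma minkowski_presentation_iso : alg_iso (minkowski_ring
  [:: poly_point alpha; poly_point beta; poly_segment alpha beta]) A.
Proof.
rewrite /minkowski_ring.
have <- : map f [:: X; Y; Z] = map (@indicator R)
    [:: poly_point alpha; poly_point beta; poly_segment alpha beta].
  by rewrite /= fX fY fZ.
exact: gen_subalg_iso minkowski_presentation_inj.
Qed.
End Iso.
End Indicators.

Section Quotient.
Variables (R : realType) (alpha beta : R) (A : comAlgType R[i]) (s : seq A).
Variables (s1 : 1 \notin gen_ideal s) (X Y Z : A).
Variable f : {lrmorphism A -> polyhedra_alg R}.
Hypothesis ab : alpha < beta.
Hypothesis fX : f X = indicator (poly_point alpha).
Hypothesis fY : f Y = indicator (poly_point beta).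
Hypothesis fZ : f Z = indicator (poly_segment alpha beta).
Hypothesis fs : forall r, r \in s -> f r = 0.
Hypothesis ZXY : (Z - X) * (Z - Y) \in s.
Hypothesis XYZ : forall q : A, q \in gen_subalg [:: X; Y; Z].
(** Required of every [p] that kills [s], since the projection is only obtained existentially in the
    proof. *)
Hypothesis XY : forall p : {lrmorphism A -> quotient_alg s s1},
  (forall r, r \in s -> p r = 0) ->
  forall i j i' j', alpha *+ i + beta *+ j = alpha *+ i' + beta *+ j' ->
  p X ^+ i * p Y ^+ j = p X ^+ i' * p Y ^+ j'.

(** [X], [Y] and [Z] need not be variables: when an endpoint is 0, the corresponding one is taken to
    be 1. *)
Lemma minkowski_quotient_iso : alg_iso (minkowski_ring
  [:: poly_point alpha; poly_point beta; poly_segment alpha beta])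
  (quotient_alg s s1).
Proof.
have [p [psurj p0]] := quotient_alg_proj s1.
have ps r : r \in s -> p r = 0.
  move=> rs; apply/p0/asboolP.
  have ri : (index r s < size s)%N by rewrite index_mem.
  (* A generator lies in the ideal through the coefficients that are 1 at its own index and 0
     elsewhere. *)
  exists (fun i => (i == Ordinal ri)%:R).
  rewrite (bigD1 (Ordinal ri))//= eqxx mul1r nth_index// big1 ?addr0//.
  by move=> i /negbTE ->; rewrite mul0r.
have pf a : p a = 0 -> f a = 0.
  move=> /p0/asboolP[c ->]; rewrite raddf_sum big1// => i _.
  by rewrite /= rmorphM /= (fs (mem_nth _ _)) ?mulr0.
have [g gE] := lrmorphism_factor psurj pf.
apply: (@minkowski_presentation_iso _ _ _ _ (p X) (p Y) (p Z) g ab);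
  rewrite ?gE//.
- by rewrite -!raddfB -rmorphM; apply: ps.
- by move=> q; have [a <-] := psurj q; apply: (gen_subalg_image p (XYZ a)).
- exact: XY.
Qed.

End Quotient.

(** * Arithmetic of weights and the four cases *)

(** Since [(i' - i) m = (j - j') n], Gauss's lemma gives that [n] divides [i' - i]; the quotient is
    [k]. Exponents of equal weight thus differ by a multiple of one fixed exchange. *)
Lemma coprime_weights m n i j i' j' : (0 < n)%N -> coprime m n ->
  (i <= i')%N -> (i * m + j * n = i' * m + j' * n)%N ->
  exists k, (i' = i + k * n /\ j = j' + k * m)%N.
Proof.
move=> n0 mn ii' e.
have /dvdnP[k kE] : (n %| i' - i)%N.
  rewrite -(@Gauss_dvdl _ _ m) 1?coprime_sym// mulnBl.
  have -> : (i' * m - i * m = (j - j') * n)%N by rewrite mulnBl; lia.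
  exact: dvdn_mull.
exists k; split; first by lia.
have e' : (j * n = (j' + k * m) * n)%N by nia.
by apply/eqP; rewrite -(eqn_pmul2r n0) e'.
Qed.

(** The common measure is [beta / n], which may be negative. *)
Lemma commensurable (R : realFieldType) (alpha beta : R) m n :
  (0 < n)%N -> alpha / beta = m%:R / n%:R ->
  beta != 0 -> exists2 t, t != 0 & alpha = m%:R * t /\ beta = n%:R * t.
Proof.
move=> n0 e b0; have n0' : n%:R != 0 :> R by rewrite pnatr_eq0 -lt0n.
exists (beta / n%:R); first by rewrite mulf_neq0 ?invr_eq0.
split; last by rewrite mulrC divfK.
by rewrite mulrA mulrAC -e divfK.
Qed.

Theorem proposition3p5 (R : realType) (alpha beta : R) (hab : alpha < beta) :
  let Rab := minkowski_ring [:: poly_point alpha; poly_point beta; poly_segment alpha beta] in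
  [/\ alpha = 0 \/ beta = 0 ->
        let x : {mpoly R[i][2]} := 'X_0 in
        let y : {mpoly R[i][2]} := 'X_1 in
        alg_iso Rab (quotient_alg [:: (y - 1) * (y - x)] (proper_xy R[i])),
      alpha <> 0 -> beta <> 0 -> irrational (alpha / beta) ->
        let x : {mpoly R[i][3]} := 'X_0 in
        let y : {mpoly R[i][3]} := 'X_1 in
        let z : {mpoly R[i][3]} := 'X_2 in
        alg_iso Rab (quotient_alg [:: (z - x) * (z - y)] (proper_xyz R[i])),
      forall m n : nat, (0 < m)%N -> (0 < n)%N -> coprime m n ->
        alpha / beta = m%:R / n%:R ->
        let x : {mpoly R[i][3]} := 'X_0 in
        let y : {mpoly R[i][3]} := 'X_1 in
        let z : {mpoly R[i][3]} := 'X_2 in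
        alg_iso Rab (quotient_alg [:: (z - x) * (z - y); y ^+ m - x ^+ n]
                       (proper_xyz_pos R[i] m n)) &
      forall m n : nat, (0 < m)%N -> (0 < n)%N -> coprime m n ->
        alpha / beta = - (m%:R / n%:R) ->
        let x : {mpoly R[i][3]} := 'X_0 in
        let y : {mpoly R[i][3]} := 'X_1 in
        let z : {mpoly R[i][3]} := 'X_2 in
        alg_iso Rab (quotient_alg [:: (z - x) * (z - y); x ^+ n * y ^+ m - 1]
                       (proper_xyz_neg R[i] m n))].
Proof.
move=> Rab.
pose pa := indicator (poly_point alpha).
pose pb := indicator (poly_point beta).
pose sg := indicator (poly_segment alpha beta).
have sgab : (sg - pa) * (sg - pb) = 0.
  by apply: indicator_segment_quadratic; apply: ltW.
have [F FE] := mpoly_lift (fun i : 'I_3 => nth 0 [:: pa; pb; sg] i).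
have F0 := FE ord0; have F1 := FE (inord 1); have F2 := FE (inord 2).
have e1 : inord 1 = 1 :> 'I_3 by apply: val_inj; rewrite /= inordK.
have e2 : inord 2 = 2 :> 'I_3 by apply: val_inj; rewrite /= inordK.
rewrite inordK//= e1 in F1; rewrite inordK//= e2 in F2.
have gen3 (q : {mpoly R[i][3]}) : q \in gen_subalg [:: 'X_0; 'X_1; 'X_2].
  apply: mpoly_gen_subalg => i; rewrite !inE.
  case: i => -[|[|[|//]]] ?; apply/or3P;
    [apply: Or31 | apply: Or32 | apply: Or33]; apply/eqP; congr 'X_(_);
    exact: val_inj.
have rel : F (('X_2 - 'X_0) * ('X_2 - 'X_1)) = 0.
  by rewrite rmorphM !raddfB /= F0 F1 F2.
(* Equality of weights is symmetric, so [i <= i'] may be assumed, as [coprime_weights] demands. *)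
have ij_sym (Q : comAlgType R[i]) (X Y : Q) :
    (forall i j i' j', (i <= i')%N ->
      alpha *+ i + beta *+ j = alpha *+ i' + beta *+ j' ->
      X ^+ i * Y ^+ j = X ^+ i' * Y ^+ j') ->
    forall i j i' j', alpha *+ i + beta *+ j = alpha *+ i' + beta *+ j' ->
      X ^+ i * Y ^+ j = X ^+ i' * Y ^+ j'.
  move=> H i j i' j'; have [ii'|/ltnW ii'] := leqP i i'; first exact: H.
  by move=> /esym e; apply/esym/H.
split.
- move=> ab0 x y.
  have [xX1 xX0] : 1 = inord 1 :> 'I_2 /\ 0 = ord0 :> 'I_2.
    by split; apply: val_inj; rewrite /= ?inordK.
  have gen2 (s : seq {mpoly R[i][2]}) : x \in s -> y \in s ->
      forall q, q \in gen_subalg s.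
    move=> xs ys; apply: mpoly_gen_subalg => i.
    by case: i => -[|[|//]] ?; [move: xs | move: ys]; congr ('X_(_) \in s);
      apply: val_inj.
  (* [x] goes to the nonzero endpoint and [y] to the segment; the point at 0 is already the unit. *)
  have [G GE] := mpoly_lift
    (fun i : 'I_2 => nth 0 [:: if alpha == 0 then pb else pa; sg] i).
  have Gx := GE 0; have Gy := GE 1; rewrite /= in Gx Gy.
  have one0 : indicator (poly_point 0) = 1 :> polyhedra_alg R by [].
  case: ab0 => [a0|b0].
    have b0 : beta != 0 by rewrite -a0 gt_eqF.
    apply: (minkowski_quotient_iso (X := 1) (Y := x) (Z := y) (f := G)) => //.
    + by rewrite rmorph1 a0.
    + by rewrite Gx a0 eqxx.
    + move=> r; rewrite inE => /eqP ->.
      rewrite rmorphM !raddfB /= rmorph1 Gx Gy.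
      by rewrite a0 eqxx -one0 -a0.
    + by rewrite mem_head.
    + by apply: gen2; rewrite !inE eqxx ?orbT.
    (* The weight is now a multiple of [beta] alone: it determines [j], and powers of 1 are all
       equal. *)
    + move=> p _ i j i' j'; rewrite a0 !mul0rn !add0r => /(mulrIn b0) ->.
      by rewrite rmorph1 !expr1n.
  have a0 : alpha != 0 by rewrite -b0 lt_eqF.
  apply: (minkowski_quotient_iso (X := x) (Y := 1) (Z := y) (f := G)) => //.
  + by rewrite Gx (negbTE a0).
  + by rewrite rmorph1 b0.
  + move=> r; rewrite inE => /eqP ->; rewrite rmorphM !raddfB /= rmorph1 Gx Gy.
    by rewrite (negbTE a0) -one0 -b0 mulrC.
  + by rewrite mulrC mem_head.
  + by apply: gen2; rewrite !inE eqxx ?orbT.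
  + move=> p _ i j i' j'; rewrite b0 !mul0rn !addr0 => /(mulrIn a0) ->.
    by rewrite rmorph1 !expr1n.
- move=> /eqP a0 /eqP b0 irr x y z.
  apply: (minkowski_quotient_iso (X := x) (Y := y) (Z := z) (f := F)) => //.
  + by move=> r; rewrite inE => /eqP ->.
  + by rewrite mem_head.
  + move=> p _; apply: ij_sym => i j i' j' ii' e.
    have [ei|/eqP ni] := eqVneq i i'.
      by move: e; rewrite ei => /addrI/(mulrIn b0) ->.
    (* Equal weights with [i != i'] would make [alpha / beta] this rational number. *)
    case: irr; exists ((j%:R - j'%:R) / (i'%:R - i%:R)) => //.
    rewrite fmorph_div !raddfB /= !ratr_nat.
    have d0 : i'%:R - i%:R != 0 :> R.
      by rewrite subr_eq0 eqr_nat; apply/eqP => /esym.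
    apply/eqP; rewrite eqr_div//; apply/eqP.
    rewrite mulrBl mulrBr !mulr_natl !mulr_natr; lra.
- move=> m n m0 n0 mn e x y z.
  (* A quotient by 0 is 0 by convention, whereas [m / n] is nonzero. *)
  have b0 : beta != 0.
    apply/eqP => b0; move: e => /eqP; rewrite b0 invr0 mulr0 eq_sym.
    by rewrite mulf_eq0 invr_eq0 !pnatr_eq0 (gtn_eqF m0) (gtn_eqF n0).
  have [t t0 [aE bE]] := commensurable n0 e b0.
  apply: (minkowski_quotient_iso (X := x) (Y := y) (Z := z) (f := F)) => //.
  + move=> r; rewrite !inE => /orP[]/eqP -> //.
    (* Both [x ^+ n] and [y ^+ m] go to the point [m n t]. *)
    rewrite raddfB /= !rmorphXn /= F0 F1 !indicator_pointX; apply/eqP.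
    rewrite subr_eq0; apply/eqP; apply: indicator_ext; congr [set _]%classic.
    by rewrite -!(mulr_natl alpha) -!(mulr_natl beta) aE bE mulrCA.
  + by rewrite mem_head.
  + move=> p pr; apply: ij_sym => i j i' j' ii' w.
    have pxy : p y ^+ m = p x ^+ n.
      apply/eqP; rewrite -subr_eq0 -!rmorphXn -raddfB; apply/eqP/pr.
      by rewrite !inE eqxx orbT.
    have [|k [-> ->]] := coprime_weights n0 mn ii' (j := j) (j' := j').
      apply/eqP; rewrite -(eqr_nat R) !natrD !natrM; apply/eqP.
      apply: (mulIf t0); move: w.
      rewrite -!(mulr_natl alpha) -!(mulr_natl beta) aE bE => w.
      by rewrite !mulrDl -!mulrA.
    (* The two monomials differ by trading [k] factors [y ^+ m] for [k] factors [x ^+ n]. *)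
    by rewrite !exprD mulnC [(k * n)%N]mulnC !exprM pxy mulrA mulrAC.
move=> m n m0 n0 mn e x y z.
have b0 : beta != 0.
  apply/eqP => b0; move: e => /eqP; rewrite b0 invr0 mulr0 eq_sym oppr_eq0.
  by rewrite mulf_eq0 invr_eq0 !pnatr_eq0 (gtn_eqF m0) (gtn_eqF n0).
have [t t0 [aE bE]] : exists2 t, t != 0 & - alpha = m%:R * t /\ beta = n%:R * t.
  by apply: commensurable => //; rewrite mulNr e opprK.
have {}aE : alpha = - (m%:R * t) by rewrite -aE opprK.
apply: (minkowski_quotient_iso (X := x) (Y := y) (Z := z) (f := F)) => //.
+ move=> r; rewrite !inE => /orP[]/eqP -> //.
  rewrite raddfB /= rmorphM !rmorphXn /= rmorph1 F0 F1 !indicator_pointX.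
  rewrite indicator_pointM; apply/eqP; rewrite subr_eq0; apply/eqP.
  apply: indicator_ext; congr [set _]%classic.
  by rewrite -!(mulr_natl alpha) -!(mulr_natl beta) aE bE mulrN mulrCA addNr.
+ by rewrite mem_head.
+ move=> p pr; apply: ij_sym => i j i' j' ii' w.
  have pxy : p x ^+ n * p y ^+ m = 1.
    apply/eqP; rewrite -subr_eq0 -!rmorphXn -rmorphM -(rmorph1 p) -raddfB.
    by apply/eqP/pr; rewrite !inE eqxx orbT.
  (* Weights are now [(j n - i m) t]; moving the negative terms across interchanges [j] and [j'].
     The monomials then differ by the factor [(x^n y^m)^k], which is 1. *)
  have [|k [-> ->]] := coprime_weights n0 mn ii' (j := j') (j' := j).
    apply/eqP; rewrite -(eqr_nat R) !natrD !natrM; apply/eqP.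
    apply: (mulIf t0); move: w.
      rewrite -!(mulr_natl alpha) -!(mulr_natl beta) aE bE => w.
    by rewrite !mulrDl -!mulrA; lra.
  rewrite !exprD mulnC [(k * m)%N]mulnC !exprM mulrACA.
  by rewrite -exprMn pxy expr1n mulr1.
Qed.
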